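(* Let $\mathbb{H}_4$ be the Sweedler Hopf algebra over $\mathbb{R}$ with basis $1,g,\nu,g\nu$, and let $\mathbb{H}_{ss}$ be the split semi-quaternion algebra over $\mathbb{R}$ with basis $1,e_1,e_2,e_3$. Let $k_1,k_2,k_3,k_4,l_1,l_2,l_3,l_4\in\mathbb{R}$ be arbitrary parameters. Define a linear map $\cdot:\mathbb{H}_4\otimes\mathbb{H}_{ss}\to\mathbb{H}_{ss}$ on basis elements by: - $1\cdot 1=1$, $1\cdot e_i=e_i$ for $i=1,2,3$; - $g\cdot 1=g\cdot e_1=g\cdot e_2=g\cdot e_3=0$; - $\nu\cdot 1=k_1 1+k_2e_1+k_3e_2-k_4e_3$, $\nu\cdot e_1=k_2 1+k_1e_1+k_4e_2-k_3e_3$, $\nu\cdot e_2=k_1e_2+k_2e_3$, $\nu\cdot e_3=k_2e_2+k_1e_3$; - $g\nu\cdot 1=l_1 1+l_2e_1+l_3e_2+l_4e_3$, $g\nu\cdot e_1=l_2 1+l_1e_1+l_4e_2+l_3e_3$, $g\nu\cdot e_2=l_1e_2-l_2e_3$, $g\nu\cdot e_3=-l_2e_2+l_1e_3$. Define a linear map $\omega:\mathbb{H}_4\otimes\mathbb{H}_4\to\mathbb{H}_{ss}$, writing $\omega(h,l)=\omega(h\otimes l)$, on basis elements by: - $\omega(1,1)=1$, $\omega(1,g)=0$, $\omega(1,\nu)=k_1 1+k_2e_1+k_3e_2-k_4e_3$, $\omega(1,g\nu)=l_1 1+l_2e_1+l_3e_2+l_4e_3$; - $\omega(g,1)=\omega(g,g)=\omega(g,\nu)=\omega(g,g\nu)=0$;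 - $\omega(\nu,1)=k_1 1+k_2e_1+k_3e_2-k_4e_3$, $\omega(\nu,g)=0$, $\omega(\nu,\nu)=(k_1^2+k_2^2)1+2k_1k_2e_1+2k_1k_3e_2-2k_1k_4e_3$, $\omega(\nu,g\nu)=(k_1l_1+k_2l_2)1+(k_2l_1+k_1l_2)e_1+(k_3l_1+k_4l_2+k_1l_3+k_2l_4)e_2+(-k_4l_1-k_3l_2+k_2l_3+k_1l_4)e_3$; - $\omega(g\nu,1)=l_1 1+l_2e_1+l_3e_2+l_4e_3$, $\omega(g\nu,g)=\omega(g\nu,g\nu)=0$, $\omega(g\nu,\nu)=(k_1l_1+k_2l_2)1+(k_2l_1+k_1l_2)e_1+(k_3l_1+k_4l_2+k_1l_3+k_2l_4)e_2+(-k_4l_1-k_3l_2+k_2l_3+k_1l_4)e_3$. Then the pair $(\cdot,\omega)$ is a twisted partial action of $\mathbb{H}_4$ on $\mathbb{H}_{ss}$.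
   Context: All algebras, tensor products and linear maps are over $\mathbb{R}$. Sweedler notation $\Delta(h)=h_1\otimes h_2$ (summation suppressed) is used. Sweedler Hopf algebra $\mathbb{H}_4$: generated by $g,\nu$ with $g^2=1$, $\nu^2=0$, $g\nu+\nu g=0$; $\Delta(g)=g\otimes g$, $\Delta(\nu)=g\otimes\nu+\nu\otimes 1$, $\varepsilon(g)=1$, $\varepsilon(\nu)=0$, $S(g)=g$, $S(\nu)=-g\nu$. It is $4$-dimensional with basis $1,g,\nu,g\nu$. Split semi-quaternion algebra $\mathbb{H}_{ss}$: the unital associative $\mathbb{R}$-algebra with basis $1,e_1,e_2,e_3$ and $e_1^2=1$, $e_2^2=0$, $e_3^2=0$, $e_1e_2=e_3=-e_2e_1$, $e_2e_3=0=-e_3e_2$, $e_3e_1=-e_2=-e_1e_3$. Twisted partial action: let $H$ be a Hopf algebra and $A$ a unital algebra with unit $1_A$. A pair of linear maps $\cdot:H\otimes A\to A$ and $\omega:H\otimes H\to A$ (with $\omega(h,l)=\omega(h\otimes l)$) is a twisted partial action of $H$ on $A$ if for all $a,b\in A$ and $h,l\in H$: (1) $1_H\cdot a=a$; (2) $h\cdot(ab)=(h_1\cdot a)(h_2\cdot b)$; (3) $(h_1\cdot(l_1\cdot a))\,\omega(h_2,l_2)=\omega(h_1,l_1)\,(h_2l_2\cdot a)$; (4) $\omega(h,l)=\omega(h_1,l_1)\,(h_2l_2\cdot 1_A)$. *)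

(* Defs.v *)
From HB Require Import structures.
From mathcomp Require Import all_boot all_order all_algebra.
From mathcomp Require Import boolp reals.
From mathcomp Require Import ring.

Set Implicit Arguments.
Unset Strict Implicit.
Unset Printing Implicit Defensive.

Import GRing.Theory.

Local Open Scope ring_scope.
Local Open Scope quotient_scope.

Reserved Notation "u ⊗ v" (at level 40, left associativity).
Reserved Notation "\tsum_ ( u , v <- t ) E"
  (at level 41, E at level 41, u name, v name,
   format "'[' \tsum_ ( u ,  v  <-  t ) '/  '  E ']'").

(* The tensor product of two K-modules: a tensor is the class of a finite     *)
(* list of pairs [:: (u_1, v_1); ..; (u_n, v_n)], read as the sum of the      *)
(* u_i ⊗ v_i, and two lists are identified when no bilinear map separates     *)
(* them.                                                                      *)
Section TensorProduct.
Variables (K : comNzRingType) (U V : lmodType K).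

Definition tensor_eq : rel (seq (U * V)) := fun s t =>
  `[< forall (W : lmodType K) (f : U -> V -> W), bilinear_for *:%R *:%R f ->
      \sum_(p <- s) f p.1 p.2 = \sum_(p <- t) f p.1 p.2 >].

Let tensor_eq_refl : reflexive tensor_eq.
Proof. by move=> s; apply/asboolP. Qed.

Let tensor_eq_sym : symmetric tensor_eq.
Proof.
by move=> s t; apply/asboolP/asboolP => + W f bf => /(_ W f bf) ->.
Qed.

Let tensor_eq_trans : transitive tensor_eq.
Proof.
move=> t s u /asboolP st /asboolP tu; apply/asboolP => W f bf.
by rewrite st // tu.
Qed.

Canonical tensor_equiv :=
  EquivRel tensor_eq tensor_eq_refl tensor_eq_sym tensor_eq_trans.

Definition tensor : Type := {eq_quot tensor_eq}.
HB.instance Definition _ := Choice.on tensor.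
HB.instance Definition _ := EqQuotient.on tensor.

Definition tens (u : U) (v : V) : tensor := \pi_tensor [:: (u, v)].

(* The map t |-> tensor_sum t f is the linear map induced by f; it is only    *)
(* meaningful for a bilinear f.                                               *)
Definition tensor_sum (t : tensor) (W : lmodType K) (f : U -> V -> W) : W :=
  \sum_(p <- repr t) f p.1 p.2.

Lemma tensor_sum_pi (W : lmodType K) (f : U -> V -> W) s :
  bilinear_for *:%R *:%R f ->
  tensor_sum (\pi_tensor s) f = \sum_(p <- s) f p.1 p.2.
Proof.
move=> bf; rewrite /tensor_sum.
have : repr (\pi_tensor s) = s %[mod tensor] by rewrite reprK.
by move=> /eqmodP /asboolP; apply.
Qed.

Lemma tensor_sum_tens (W : lmodType K) (f : U -> V -> W) u v :
  bilinear_for *:%R *:%R f -> tensor_sum (tens u v) f = f u v.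
Proof. by move=> bf; rewrite tensor_sum_pi // big_seq1. Qed.

Lemma tensorP (s t : tensor) :
  (forall (W : lmodType K) (f : U -> V -> W), bilinear_for *:%R *:%R f ->
    tensor_sum s f = tensor_sum t f) -> s = t.
Proof.
move=> st; rewrite -[s]reprK -[t]reprK; apply/eqmodP/asboolP => W f bf.
exact: st.
Qed.

Definition tensor_add (s t : tensor) : tensor :=
  \pi_tensor (repr s ++ repr t).
Definition tensor_scale (a : K) (t : tensor) : tensor :=
  \pi_tensor [seq (a *: p.1, p.2) | p <- repr t].
Definition tensor_zero : tensor := \pi_tensor [::].
Definition tensor_opp (t : tensor) : tensor := tensor_scale (-1) t.

Section Lift.
Variables (W : lmodType K) (f : U -> V -> W).
Hypothesis bf : bilinear_for *:%R *:%R f.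

Let fD s t : tensor_sum (tensor_add s t) f = tensor_sum s f + tensor_sum t f.
Proof. by rewrite tensor_sum_pi // big_cat. Qed.

Let fZ a t : tensor_sum (tensor_scale a t) f = a *: tensor_sum t f.
Proof.
rewrite tensor_sum_pi // big_map scaler_sumr; apply: eq_bigr => p _ /=.
exact: (scalable_linear (bf.1 p.2)).
Qed.

Let f0 : tensor_sum tensor_zero f = 0.
Proof. by rewrite tensor_sum_pi // big_nil. Qed.

Let fN t : tensor_sum (tensor_opp t) f = - tensor_sum t f.
Proof. by rewrite fZ scaleN1r. Qed.

Definition tensor_sumE := (fD, fZ, f0, fN).
End Lift.

Let tensor_addA : associative tensor_add.
Proof.
by move=> s t u; apply: tensorP => W f bf; rewrite !(tensor_sumE bf) addrA.
Qed.
Let tensor_addC : commutative tensor_add.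
Proof.
by move=> s t; apply: tensorP => W f bf; rewrite !(tensor_sumE bf) addrC.
Qed.
Let tensor_add0 : left_id tensor_zero tensor_add.
Proof.
by move=> s; apply: tensorP => W f bf; rewrite !(tensor_sumE bf) add0r.
Qed.
Let tensor_addN : left_inverse tensor_zero tensor_opp tensor_add.
Proof.
by move=> s; apply: tensorP => W f bf; rewrite !(tensor_sumE bf) addNr.
Qed.
HB.instance Definition _ := GRing.isZmodule.Build tensor
  tensor_addA tensor_addC tensor_add0 tensor_addN.

Let tensor_scaleA a b t :
  tensor_scale a (tensor_scale b t) = tensor_scale (a * b) t.
Proof. by apply: tensorP => W f bf; rewrite !(tensor_sumE bf) scalerA. Qed.
Let tensor_scale1 : left_id 1 tensor_scale.
Proof.
by move=> s; apply: tensorP => W f bf; rewrite !(tensor_sumE bf) scale1r.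
Qed.
Let tensor_scaleDr : right_distributive tensor_scale +%R.
Proof.
by move=> a s t; apply: tensorP => W f bf; rewrite !(tensor_sumE bf) scalerDr.
Qed.
Let tensor_scaleDl t : {morph tensor_scale^~ t : a b / a + b}.
Proof.
by move=> a b; apply: tensorP => W f bf; rewrite !(tensor_sumE bf) scalerDl.
Qed.
HB.instance Definition _ := GRing.Zmodule_isLmodule.Build K tensor
  tensor_scaleA tensor_scale1 tensor_scaleDr tensor_scaleDl.

Lemma tensor_sum_linear (W : lmodType K) (f : U -> V -> W) :
  bilinear_for *:%R *:%R f -> linear (fun t => tensor_sum t f).
Proof.
move=> bf a s t; rewrite /GRing.add /GRing.scale /=.
by rewrite !(tensor_sumE bf).
Qed.

Lemma tens_bilinear : bilinear_for *:%R *:%R tens.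
Proof.
split=> [v a u u'|u a v v']; apply: tensorP => W f bf;
  rewrite (tensor_sum_linear bf) !tensor_sum_tens //.
  exact: bf.1.
exact: bf.2.
Qed.

Lemma tens_span (t : tensor) : t = \sum_(p <- repr t) tens p.1 p.2.
Proof.
have tz s : \pi_tensor s = \sum_(p <- s) tens p.1 p.2 :> tensor.
  elim: s => [|p s IHs]; first by rewrite big_nil.
  rewrite big_cons -IHs; apply: tensorP => W f bf.
  by rewrite (tensor_sumE bf) !tensor_sum_pi // big_cons big_seq1.
by rewrite -tz reprK.
Qed.

Lemma tensor_sum_linearr (W : lmodType K) (f g : U -> V -> W) a t :
  tensor_sum t (fun u v => a *: f u v + g u v) =
  a *: tensor_sum t f + tensor_sum t g.
Proof. by rewrite /tensor_sum big_split scaler_sumr. Qed.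

End TensorProduct.

Notation "u ⊗ v" := (tens u v) : ring_scope.
Notation "U ⊗ V" := (tensor U V) : type_scope.
Notation "\tsum_ ( u , v <- t ) E" := (tensor_sum t (fun u v => E)) : ring_scope.

Section TensorTheory.
Variables (K : comNzRingType) (U V : lmodType K).

Lemma tensDl (u u' : U) (v : V) :
  (u + u') ⊗ v = u ⊗ v + u' ⊗ v.
Proof. by have := (tens_bilinear U V).1 v 1 u u'; rewrite /= !scale1r. Qed.
Lemma tensDr (u : U) (v v' : V) :
  u ⊗ (v + v') = u ⊗ v + u ⊗ v'.
Proof. by have := (tens_bilinear U V).2 u 1 v v'; rewrite /= !scale1r. Qed.
Lemma tensZl a (u : U) (v : V) : (a *: u) ⊗ v = a *: (u ⊗ v).
Proof. exact: (scalable_linear ((tens_bilinear U V).1 v)). Qed.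
Lemma tensZr a (u : U) (v : V) : u ⊗ (a *: v) = a *: (u ⊗ v).
Proof. exact: (scalable_linear ((tens_bilinear U V).2 u)). Qed.
Lemma tensNl (u : U) (v : V) : (- u) ⊗ v = - (u ⊗ v).
Proof. by rewrite -scaleN1r tensZl scaleN1r. Qed.
Lemma tensNr (u : U) (v : V) : u ⊗ (- v) = - (u ⊗ v).
Proof. by rewrite -scaleN1r tensZr scaleN1r. Qed.
Lemma tens0l (v : V) : (0 : U) ⊗ v = 0.
Proof. by rewrite -(scale0r 0) tensZl scale0r. Qed.
Lemma tens0r (u : U) : u ⊗ (0 : V) = 0.
Proof. by rewrite -(scale0r 0) tensZr scale0r. Qed.
End TensorTheory.

(* Sweedler's notation: \tsum_(h1, h2 <- comul h) F h1 h2 is F(h_1, h_2).     *)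
HB.mixin Record isHopfAlgebra (K : comNzRingType) H of GRing.Algebra K H := {
  comul : {linear H -> (H ⊗ H)%type};
  counit : {linear H -> K^o};
  antipode : {linear H -> H};
  comulA : forall h : H,
    \tsum_(h1, h2 <- comul h) \tsum_(h11, h12 <- comul h1) h11 ⊗ (h12 ⊗ h2) =
    \tsum_(h1, h2 <- comul h) \tsum_(h21, h22 <- comul h2) h1 ⊗ (h21 ⊗ h22);
  counitl : forall h : H, \tsum_(h1, h2 <- comul h) (counit h1 : K) *: h2 = h;
  counitr : forall h : H, \tsum_(h1, h2 <- comul h) (counit h2 : K) *: h1 = h;
  comul1 : comul 1 = 1 ⊗ 1;
  comulM : forall h l : H, comul (h * l) =
    \tsum_(h1, h2 <- comul h) \tsum_(l1, l2 <- comul l) (h1 * l1) ⊗ (h2 * l2);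
  counit1 : counit 1 = 1;
  counitM : forall h l : H, counit (h * l) = counit h * counit l;
  antipodel : forall h : H,
    \tsum_(h1, h2 <- comul h) antipode h1 * h2 = (counit h : K) *: 1;
  antipoder : forall h : H,
    \tsum_(h1, h2 <- comul h) h1 * antipode h2 = (counit h : K) *: 1
}.

#[short(type="hopfAlgType")]
HB.structure Definition HopfAlgebra (K : comNzRingType) :=
  {H of isHopfAlgebra K H & GRing.Algebra K H}.

Section TwistedPartialAction.
Variables (K : comNzRingType) (H : hopfAlgType K) (A : algType K).

Record twisted_partial_action
    (act : {linear (H ⊗ A)%type -> A}) (omega : {linear (H ⊗ H)%type -> A}) :
    Prop := TwistedPartialAction {
  tpa_act1 : forall a : A, act (1 ⊗ a) = a;
  tpa_actM : forall (h : H) (a b : A),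
    act (h ⊗ (a * b)) =
    \tsum_(h1, h2 <- comul h) act (h1 ⊗ a) * act (h2 ⊗ b);
  tpa_twisted : forall (h l : H) (a : A),
    \tsum_(h1, h2 <- comul h) \tsum_(l1, l2 <- comul l)
       act (h1 ⊗ act (l1 ⊗ a)) * omega (h2 ⊗ l2) =
    \tsum_(h1, h2 <- comul h) \tsum_(l1, l2 <- comul l)
       omega (h1 ⊗ l1) * act ((h2 * l2) ⊗ a);
  tpa_omega : forall h l : H,
    omega (h ⊗ l) =
    \tsum_(h1, h2 <- comul h) \tsum_(l1, l2 <- comul l)
       omega (h1 ⊗ l1) * act ((h2 * l2) ⊗ 1)
}.

End TwistedPartialAction.

(* (x0, x1, x2, x3) stands for x0 1 + x1 e1 + x2 e2 + x3 e3.                  *)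
Definition ssquat (K : Type) : Type := (K * K * K * K)%type.

Section SplitSemiQuaternions.
Variable K : comNzRingType.

HB.instance Definition _ :=
  GRing.Lmodule.copy (ssquat K) (K^o * K^o * K^o * K^o)%type.

Definition ssquat1 : ssquat K := (1, 0, 0, 0).
Definition e1 : ssquat K := (0, 1, 0, 0).
Definition e2 : ssquat K := (0, 0, 1, 0).
Definition e3 : ssquat K := (0, 0, 0, 1).

Definition ssquat_mul (x y : ssquat K) : ssquat K :=
  let: (x0, x1, x2, x3) := x in
  let: (y0, y1, y2, y3) := y in
  (x0 * y0 + x1 * y1,
   x0 * y1 + x1 * y0,
   x0 * y2 + x2 * y0 + x1 * y3 - x3 * y1,
   x0 * y3 + x3 * y0 + x1 * y2 - x2 * y1).

Lemma ssquat_addE (x0 x1 x2 x3 y0 y1 y2 y3 : K) :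
  ((x0, x1, x2, x3) : ssquat K) + ((y0, y1, y2, y3) : ssquat K) =
  (x0 + y0, x1 + y1, x2 + y2, x3 + y3).
Proof. by []. Qed.

Lemma ssquat_scaleE (a x0 x1 x2 x3 : K) :
  a *: ((x0, x1, x2, x3) : ssquat K) = (a * x0, a * x1, a * x2, a * x3).
Proof. by []. Qed.

Let ssquat_mulA : associative ssquat_mul.
Proof.
move=> [[[x0 x1] x2] x3] [[[y0 y1] y2] y3] [[[z0 z1] z2] z3].
by rewrite /ssquat_mul; do 3?[congr pair]; ring.
Qed.
Let ssquat_mul1l : left_id ssquat1 ssquat_mul.
Proof.
move=> [[[x0 x1] x2] x3].
by rewrite /ssquat_mul; do 3?[congr pair]; ring.
Qed.
Let ssquat_mul1r : right_id ssquat1 ssquat_mul.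
Proof.
move=> [[[x0 x1] x2] x3].
by rewrite /ssquat_mul; do 3?[congr pair]; ring.
Qed.
Let ssquat_mulDl : left_distributive ssquat_mul +%R.
Proof.
move=> [[[x0 x1] x2] x3] [[[y0 y1] y2] y3] [[[z0 z1] z2] z3].
by rewrite ssquat_addE /ssquat_mul ssquat_addE; do 3?[congr pair]; ring.
Qed.
Let ssquat_mulDr : right_distributive ssquat_mul +%R.
Proof.
move=> [[[x0 x1] x2] x3] [[[y0 y1] y2] y3] [[[z0 z1] z2] z3].
by rewrite ssquat_addE /ssquat_mul ssquat_addE; do 3?[congr pair]; ring.
Qed.
Let ssquat1_neq0 : ssquat1 != 0.
Proof.
apply/eqP => /(congr1 (fun x : ssquat K => x.1.1.1)) /eqP.
by rewrite oner_eq0.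
Qed.
HB.instance Definition _ := GRing.Zmodule_isNzRing.Build (ssquat K)
  ssquat_mulA ssquat_mul1l ssquat_mul1r ssquat_mulDl ssquat_mulDr ssquat1_neq0.

Lemma ssquat_mulE (x y : ssquat K) : x * y = ssquat_mul x y.
Proof. by []. Qed.

Let ssquat_scaleAl (a : K) (x y : ssquat K) : a *: (x * y) = (a *: x) * y.
Proof.
case: x y => [[[x0 x1] x2] x3] [[[y0 y1] y2] y3].
rewrite !ssquat_mulE /ssquat_mul !ssquat_scaleE.
by do 3?[congr pair]; ring.
Qed.
HB.instance Definition _ :=
  GRing.Lmodule_isLalgebra.Build K (ssquat K) ssquat_scaleAl.

Let ssquat_scaleAr (a : K) (x y : ssquat K) : a *: (x * y) = x * (a *: y).
Proof.
case: x y => [[[x0 x1] x2] x3] [[[y0 y1] y2] y3].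
rewrite !ssquat_mulE /ssquat_mul !ssquat_scaleE.
by do 3?[congr pair]; ring.
Qed.
HB.instance Definition _ :=
  GRing.Lalgebra_isAlgebra.Build K (ssquat K) ssquat_scaleAr.

Definition ssquat_coord (x : ssquat K) : 'rV[K]_4 :=
  let: (x0, x1, x2, x3) := x in \row_(i < 4) [:: x0; x1; x2; x3]`_i.

Let ssquat_coord_linear : linear ssquat_coord.
Proof.
move=> a [[[x0 x1] x2] x3] [[[y0 y1] y2] y3]; apply/rowP.
by rewrite ssquat_scaleE ssquat_addE; case=> -[|[|[|[|//]]]] ?; rewrite !mxE.
Qed.
HB.instance Definition _ :=
  GRing.isLinear.Build K (ssquat K) 'rV_4 _ ssquat_coord ssquat_coord_linear.

Lemma ssquat_basis (x : ssquat K) :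
  x = ssquat_coord x 0 0 *: 1 + ssquat_coord x 0 1 *: e1
    + ssquat_coord x 0 2 *: e2 + ssquat_coord x 0 3 *: e3.
Proof.
case: x => [[[x0 x1] x2] x3]; rewrite !mxE /=.
change (1 : ssquat K) with ssquat1; rewrite /ssquat1 /e1 /e2 /e3.
rewrite !ssquat_scaleE !ssquat_addE.
by do 3?[congr pair]; rewrite /=; ring.
Qed.

Section LinearExtension.
Variables (W : lmodType K) (w0 w1 w2 w3 : W).

(* The linear map with values w0, w1, w2, w3 at 1, e1, e2, e3.                *)
Definition ssquat_ext (x : ssquat K) : W :=
  ssquat_coord x 0 0 *: w0 + ssquat_coord x 0 1 *: w1
  + ssquat_coord x 0 2 *: w2 + ssquat_coord x 0 3 *: w3.

Let ssquat_ext_linear : linear ssquat_ext.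
Proof.
move=> a x y; rewrite /ssquat_ext linearP !mxE !scalerDl -!scalerA.
by do 3![rewrite ?scalerDr [RHS]addrACA; congr (_ + _)].
Qed.
HB.instance Definition _ :=
  GRing.isLinear.Build K (ssquat K) W _ ssquat_ext ssquat_ext_linear.

Lemma ssquat_ext1 : ssquat_ext 1 = w0.
Proof. by rewrite /ssquat_ext !mxE /= scale1r !scale0r !addr0. Qed.
Lemma ssquat_exte1 : ssquat_ext e1 = w1.
Proof. by rewrite /ssquat_ext !mxE /= scale1r !scale0r add0r !addr0. Qed.
Lemma ssquat_exte2 : ssquat_ext e2 = w2.
Proof. by rewrite /ssquat_ext !mxE /= scale1r !scale0r !add0r addr0. Qed.
Lemma ssquat_exte3 : ssquat_ext e3 = w3.
Proof. by rewrite /ssquat_ext !mxE /= scale1r !scale0r !add0r. Qed.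
End LinearExtension.

Ltac ssquat_table :=
  rewrite ssquat_mulE /ssquat_mul; do 3?[congr pair]; rewrite /=; ring.

Lemma mul_e1e1 : e1 * e1 = 1. Proof. by ssquat_table. Qed.
Lemma mul_e1e2 : e1 * e2 = e3. Proof. by ssquat_table. Qed.
Lemma mul_e1e3 : e1 * e3 = e2. Proof. by ssquat_table. Qed.
Lemma mul_e2e1 : e2 * e1 = - e3. Proof. by ssquat_table. Qed.
Lemma mul_e2e2 : e2 * e2 = 0. Proof. by ssquat_table. Qed.
Lemma mul_e2e3 : e2 * e3 = 0. Proof. by ssquat_table. Qed.
Lemma mul_e3e1 : e3 * e1 = - e2. Proof. by ssquat_table. Qed.
Lemma mul_e3e2 : e3 * e2 = 0. Proof. by ssquat_table. Qed.
Lemma mul_e3e3 : e3 * e3 = 0. Proof. by ssquat_table. Qed.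

End SplitSemiQuaternions.

Arguments e1 {K}.
Arguments e2 {K}.
Arguments e3 {K}.

(* H_4 with basis 1, g, nu, g nu: as an algebra it has the same structure     *)
(* constants as the split semi-quaternions, with g = e1, nu = e2 and          *)
(* g nu = e3.                                                                 *)
Definition sweedler4 (K : Type) : Type := ssquat K.

Section SweedlerHopfAlgebra.
Variable K : comNzRingType.
Local Notation H4 := (sweedler4 K).

HB.instance Definition _ := GRing.Algebra.copy H4 (ssquat K).

Definition sw_g : H4 := @e1 K.
Definition sw_nu : H4 := @e2 K.
Local Notation g := sw_g.
Local Notation nu := sw_nu.

Lemma mul_gg : g * g = 1. Proof. exact: mul_e1e1. Qed.
Lemma mul_nunu : nu * nu = 0. Proof. exact: mul_e2e2. Qed.
Lemma mul_gnu : g * nu + nu * g = 0.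
Proof.
have -> : nu * g = - (g * nu) by rewrite [g * nu]mul_e1e2; exact: mul_e2e1.
exact: subrr.
Qed.
Let gnuE : g * nu = @e3 K. Proof. exact: mul_e1e2. Qed.
Let mul_nug : nu * g = - (g * nu).
Proof. by apply/eqP; rewrite -addr_eq0 addrC mul_gnu. Qed.
Let mul_g_gnu : g * (g * nu) = nu. Proof. by rewrite mulrA mul_gg mul1r. Qed.
Let mul_gnu_g : (g * nu) * g = - nu.
Proof. by rewrite -mulrA mul_nug mulrN mul_g_gnu. Qed.
Let mul_nu_gnu : nu * (g * nu) = 0.
Proof. by rewrite mulrA mul_nug mulNr -mulrA mul_nunu mulr0 oppr0. Qed.
Let mul_gnu_nu : (g * nu) * nu = 0.
Proof. by rewrite -mulrA mul_nunu mulr0. Qed.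
Let mul_gnu_gnu : (g * nu) * (g * nu) = 0.
Proof. by rewrite -mulrA mul_nu_gnu mulr0. Qed.
Let mulE := (mul_gg, mul_nug, mul_nunu, mul_g_gnu, mul_gnu_g, mul_nu_gnu,
  mul_gnu_nu, mul_gnu_gnu, mul1r, mulr1).

(* The linear map with values w0, w1, w2, w3 at 1, g, nu, g nu.               *)
Definition sweedler4_ext (W : lmodType K) (w0 w1 w2 w3 : W) : H4 -> W :=
  ssquat_ext w0 w1 w2 w3.
HB.instance Definition _ (W : lmodType K) (w0 w1 w2 w3 : W) :=
  GRing.isLinear.Build K H4 W _ (sweedler4_ext w0 w1 w2 w3)
    (linearP (ssquat_ext w0 w1 w2 w3)).

Section ExtensionValues.
Variables (W : lmodType K) (w0 w1 w2 w3 : W).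
Lemma sweedler4_ext1 : sweedler4_ext w0 w1 w2 w3 1 = w0.
Proof. exact: ssquat_ext1. Qed.
Lemma sweedler4_extg : sweedler4_ext w0 w1 w2 w3 g = w1.
Proof. exact: ssquat_exte1. Qed.
Lemma sweedler4_extnu : sweedler4_ext w0 w1 w2 w3 nu = w2.
Proof. exact: ssquat_exte2. Qed.
Lemma sweedler4_extgnu : sweedler4_ext w0 w1 w2 w3 (g * nu) = w3.
Proof. by rewrite gnuE; exact: ssquat_exte3. Qed.
End ExtensionValues.
Let extE := (sweedler4_ext1, sweedler4_extgnu, sweedler4_extg, sweedler4_extnu).

Lemma sweedler4_ext_id (x : H4) : x = sweedler4_ext 1 g nu (g * nu) x.
Proof. by rewrite gnuE; exact: ssquat_basis. Qed.

Lemma sweedler4_eq (W : lmodType K) (L M : H4 -> W) :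
  linear L -> linear M -> L 1 = M 1 -> L g = M g -> L nu = M nu ->
  L (g * nu) = M (g * nu) -> forall h, L h = M h.
Proof.
have extL (F : H4 -> W) : linear F ->
    forall x, F x = sweedler4_ext (F 1) (F g) (F nu) (F (g * nu)) x.
  move=> linF x; rewrite [x in LHS]sweedler4_ext_id.
  pose F' : {linear H4 -> W} :=
    HB.pack F (GRing.isLinear.Build K H4 W _ F linF).
  by rewrite -[F]/(F' : H4 -> W) /sweedler4_ext /ssquat_ext 3!linearD 4!linearZ.
by move=> linL linM E1 Eg En Egn x; rewrite (extL L) // (extL M) // E1 Eg En Egn.
Qed.

Definition sweedler4_comul : H4 -> (H4 ⊗ H4)%type :=
  sweedler4_ext (1 ⊗ 1) (g ⊗ g) (g ⊗ nu + nu ⊗ 1) (1 ⊗ (g * nu) + (g * nu) ⊗ g).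
HB.instance Definition _ := GRing.Linear.on sweedler4_comul.

Definition sweedler4_counit : H4 -> K^o := sweedler4_ext 1 1 0 0.
HB.instance Definition _ := GRing.Linear.on sweedler4_counit.

Definition sweedler4_antipode : H4 -> H4 := sweedler4_ext 1 g (- (g * nu)) nu.
HB.instance Definition _ := GRing.Linear.on sweedler4_antipode.

#[local] Opaque sw_g sw_nu sweedler4_ext.

Local Notation D := sweedler4_comul.
Local Notation eps := sweedler4_counit.
Local Notation S := sweedler4_antipode.

Let tensE := (tensDl, tensDr, tensNl, tensNr, tens0l, tens0r).

Section Sums.
Variables (W : lmodType K) (f : H4 -> H4 -> W).
Hypothesis bf : bilinear_for *:%R *:%R f.

Lemma sweedler4_sum_linear : linear (fun h => tensor_sum (D h) f).
Proof. by move=> a x y; rewrite linearP (tensor_sum_linear bf). Qed.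

Let tsumD s t : tensor_sum (s + t) f = tensor_sum s f + tensor_sum t f.
Proof.
by have := tensor_sum_linear bf 1 s t; rewrite /= !scale1r.
Qed.

Lemma sweedler4_sum1 : tensor_sum (D 1) f = f 1 1.
Proof. by rewrite /D extE tensor_sum_tens. Qed.
Lemma sweedler4_sumg : tensor_sum (D g) f = f g g.
Proof. by rewrite /D extE tensor_sum_tens. Qed.
Lemma sweedler4_sumnu : tensor_sum (D nu) f = f g nu + f nu 1.
Proof. by rewrite /D extE tsumD !tensor_sum_tens. Qed.
Lemma sweedler4_sumgnu :
  tensor_sum (D (g * nu)) f = f 1 (g * nu) + f (g * nu) g.
Proof. by rewrite /D extE tsumD !tensor_sum_tens. Qed.
End Sums.

Let D1 : D 1 = 1 ⊗ 1. Proof. exact: sweedler4_ext1. Qed.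
Let Dg : D g = g ⊗ g. Proof. exact: sweedler4_extg. Qed.
Let Dnu : D nu = g ⊗ nu + nu ⊗ 1. Proof. exact: sweedler4_extnu. Qed.
Let Dgnu : D (g * nu) = 1 ⊗ (g * nu) + (g * nu) ⊗ g. Proof. exact: sweedler4_extgnu. Qed.

#[local] Opaque sweedler4_comul.

Let counitl h : \tsum_(h1, h2 <- D h) (eps h1 : K) *: h2 = h.
Proof.
have bf : bilinear_for *:%R *:%R (fun h1 h2 : H4 => (eps h1 : K) *: h2).
  split=> [v a u u'|u a v v'] /=; first by rewrite linearP /= scalerDl scalerA.
  by rewrite scalerDr !scalerA mulrC.
move: h; apply: (@sweedler4_eq _ (fun h => tensor_sum (D h) _) id) => //.
- exact: sweedler4_sum_linear.
1: rewrite (sweedler4_sum1 bf).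
2: rewrite (sweedler4_sumg bf).
3: rewrite (sweedler4_sumnu bf).
4: rewrite (sweedler4_sumgnu bf).
all: rewrite /eps !extE ?scale1r ?scale0r ?addr0 ?add0r //.
Qed.

Let counitr h : \tsum_(h1, h2 <- D h) (eps h2 : K) *: h1 = h.
Proof.
have bf : bilinear_for *:%R *:%R (fun h1 h2 : H4 => (eps h2 : K) *: h1).
  split=> [v a u u'|u a v v'] /=; last by rewrite linearP /= scalerDl scalerA.
  by rewrite scalerDr !scalerA mulrC.
move: h; apply: (@sweedler4_eq _ (fun h => tensor_sum (D h) _) id) => //.
- exact: sweedler4_sum_linear.
1: rewrite (sweedler4_sum1 bf).
2: rewrite (sweedler4_sumg bf).
3: rewrite (sweedler4_sumnu bf).
4: rewrite (sweedler4_sumgnu bf).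
all: rewrite /eps !extE ?scale1r ?scale0r ?addr0 ?add0r //.
Qed.

Let counit_linear1 : linear (fun h => (eps h : K) *: (1 : H4)).
Proof. by move=> a x y; rewrite linearP /= scalerDl scalerA. Qed.

Let antipodel h : \tsum_(h1, h2 <- D h) S h1 * h2 = (eps h : K) *: 1.
Proof.
have bf : bilinear_for *:%R *:%R (fun h1 h2 : H4 => S h1 * h2).
  split=> [v a u u'|u a v v'] /=; first by rewrite linearP /= mulrDl scalerAl.
  by rewrite mulrDr scalerAr.
move: h; apply: (@sweedler4_eq _ (fun h => tensor_sum (D h) _)
  (fun h => (eps h : K) *: 1)) => //.
- exact: sweedler4_sum_linear.
1: rewrite (sweedler4_sum1 bf).
2: rewrite (sweedler4_sumg bf).
3: rewrite (sweedler4_sumnu bf).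
4: rewrite (sweedler4_sumgnu bf).
all: rewrite /S /eps !extE ?mulNr ?mulE ?scale1r ?scale0r //.
all: by rewrite ?subrr ?addNr.
Qed.

Let antipoder h : \tsum_(h1, h2 <- D h) h1 * S h2 = (eps h : K) *: 1.
Proof.
have bf : bilinear_for *:%R *:%R (fun h1 h2 : H4 => h1 * S h2).
  split=> [v a u u'|u a v v'] /=; last by rewrite linearP /= mulrDr scalerAr.
  by rewrite mulrDl scalerAl.
move: h; apply: (@sweedler4_eq _ (fun h => tensor_sum (D h) _)
  (fun h => (eps h : K) *: 1)) => //.
- exact: sweedler4_sum_linear.
1: rewrite (sweedler4_sum1 bf).
2: rewrite (sweedler4_sumg bf).
3: rewrite (sweedler4_sumnu bf).
4: rewrite (sweedler4_sumgnu bf).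
all: rewrite /S /eps !extE ?mulrN ?mulE ?scale1r ?scale0r //.
all: by rewrite ?subrr ?addNr.
Qed.

Let counitM h l : eps (h * l) = eps h * eps l :> K.
Proof.
move: h; apply: (@sweedler4_eq K^o (fun h => eps (h * l))
  (fun h => eps h * eps l : K)).
- by move=> a x y; rewrite mulrDl -scalerAl linearP.
- by move=> a x y; rewrite linearP /= mulrDl -mulrA.
all: move: l; apply: (@sweedler4_eq K^o (fun l => eps (_ * l))
  (fun l => eps _ * eps l : K)).
all: try by move=> a x y; rewrite mulrDr -scalerAr linearP.
all: try by move=> a x y; rewrite linearP /= mulrDr mulrCA.
all: rewrite ?mulE ?linearN ?linear0 /= /eps !extE ?mul1r ?mulr1 ?mulr0 ?mul0r ?oppr0 //.
Qed.

Let tens_tensl_bilin (v : H4) :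
  bilinear_for *:%R *:%R (fun u w : H4 => u ⊗ (w ⊗ v)).
Proof.
by split=> [w a u u'|u a w w'] /=; rewrite ?tensDl ?tensDr ?tensZl ?tensZr
  ?tensDr ?tensZr.
Qed.

Let tens_tensr_bilin (u : H4) :
  bilinear_for *:%R *:%R (fun w v : H4 => u ⊗ (w ⊗ v)).
Proof.
by split=> [w a v v'|v a w w'] /=; rewrite ?tensDl ?tensDr ?tensZl ?tensZr
  ?tensDr ?tensZr.
Qed.

Let TL (v h : H4) := \tsum_(h1, h2 <- D h) h1 ⊗ (h2 ⊗ v).
Let TR (u h : H4) := \tsum_(h1, h2 <- D h) u ⊗ (h1 ⊗ h2).

Let TL_linear v : linear (TL v).
Proof. exact: (sweedler4_sum_linear (tens_tensl_bilin v)). Qed.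
Let TR_linear u : linear (TR u).
Proof. exact: (sweedler4_sum_linear (tens_tensr_bilin u)). Qed.
Let TLE v :
  (TL v 1 = 1 ⊗ (1 ⊗ v)) * (TL v g = g ⊗ (g ⊗ v)) *
  (TL v nu = g ⊗ (nu ⊗ v) + nu ⊗ (1 ⊗ v)) *
  (TL v (g * nu) = 1 ⊗ ((g * nu) ⊗ v) + (g * nu) ⊗ (g ⊗ v)).
Proof.
have bf := tens_tensl_bilin v; rewrite /TL; do 3?split.
- exact: (sweedler4_sum1 bf).
- exact: (sweedler4_sumg bf).
- exact: (sweedler4_sumnu bf).
- exact: (sweedler4_sumgnu bf).
Qed.
Let TRE u :
  (TR u 1 = u ⊗ (1 ⊗ 1)) * (TR u g = u ⊗ (g ⊗ g)) *
  (TR u nu = u ⊗ (g ⊗ nu) + u ⊗ (nu ⊗ 1)) *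
  (TR u (g * nu) = u ⊗ (1 ⊗ (g * nu)) + u ⊗ ((g * nu) ⊗ g)).
Proof.
have bf := tens_tensr_bilin u; rewrite /TR; do 3?split.
- exact: (sweedler4_sum1 bf).
- exact: (sweedler4_sumg bf).
- exact: (sweedler4_sumnu bf).
- exact: (sweedler4_sumgnu bf).
Qed.

Let comulA h :
  \tsum_(h1, h2 <- D h) \tsum_(h11, h12 <- D h1) h11 ⊗ (h12 ⊗ h2) =
  \tsum_(h1, h2 <- D h) \tsum_(h21, h22 <- D h2) h1 ⊗ (h21 ⊗ h22).
Proof.
have bl : bilinear_for *:%R *:%R (fun h1 h2 : H4 => TL h2 h1).
  split=> [v a u u'|u a v v'] /=; first exact: TL_linear.
  rewrite -tensor_sum_linearr; congr tensor_sum.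
  by apply/funext => x; apply/funext => y; rewrite !tensE !tensZr.
have br : bilinear_for *:%R *:%R TR.
  split=> [v a u u'|u a v v'] /=; last exact: TR_linear.
  rewrite -tensor_sum_linearr; congr tensor_sum.
  by apply/funext => x; apply/funext => y; rewrite !tensE !tensZl.
rewrite -[LHS]/(tensor_sum (D h) (fun h1 h2 => TL h2 h1)).
rewrite -[RHS]/(tensor_sum (D h) TR).
move: h; apply: (@sweedler4_eq _
  (fun h => tensor_sum (D h) _) (fun h => tensor_sum (D h) _)).
- exact: (sweedler4_sum_linear bl).
- exact: (sweedler4_sum_linear br).
- by rewrite (sweedler4_sum1 bl) (sweedler4_sum1 br) TLE TRE.
- by rewrite (sweedler4_sumg bl) (sweedler4_sumg br) TLE TRE.
- by rewrite (sweedler4_sumnu bl) (sweedler4_sumnu br) !TLE !TRE addrA.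
- by rewrite (sweedler4_sumgnu bl) (sweedler4_sumgnu br) !TLE !TRE addrA.
Qed.

Let tens_mul_bilin (u v : H4) :
  bilinear_for *:%R *:%R (fun l1 l2 : H4 => (u * l1) ⊗ (v * l2)).
Proof.
by split=> [w a x x'|x a w w'] /=;
  rewrite mulrDr -scalerAr ?tensDl ?tensDr ?tensZl ?tensZr.
Qed.

Let T (u v l : H4) := \tsum_(l1, l2 <- D l) (u * l1) ⊗ (v * l2).

Let T_linear u v : linear (T u v).
Proof. exact: (sweedler4_sum_linear (tens_mul_bilin u v)). Qed.
Let T1 u v : T u v 1 = u ⊗ v.
Proof. by rewrite /T (sweedler4_sum1 (tens_mul_bilin u v)) !mulr1. Qed.
Let Tg u v : T u v g = (u * g) ⊗ (v * g).
Proof. exact: (sweedler4_sumg (tens_mul_bilin u v)). Qed.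
Let Tnu u v : T u v nu = (u * g) ⊗ (v * nu) + (u * nu) ⊗ v.
Proof. by rewrite /T (sweedler4_sumnu (tens_mul_bilin u v)) mulr1. Qed.
Let Tgnu u v :
  T u v (g * nu) = u ⊗ (v * (g * nu)) + (u * (g * nu)) ⊗ (v * g).
Proof. by rewrite /T (sweedler4_sumgnu (tens_mul_bilin u v)) mulr1. Qed.

#[local] Opaque T.

Let comulM_basis h (M : H4 -> (H4 ⊗ H4)%type) : linear M ->
  D h = M 1 -> D (h * g) = M g -> D (h * nu) = M nu ->
  D (h * (g * nu)) = M (g * nu) -> forall l, D (h * l) = M l.
Proof.
move=> linM E1 Eg Enu Egnu; apply: (@sweedler4_eq _ (fun l => D (h * l)) M) => //.
- by move=> a x y; rewrite mulrDr -scalerAr linearP.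
- by rewrite mulr1.
Qed.

Let TD_linear u v u' v' : linear (fun l => T u v l + T u' v' l).
Proof. by move=> a x y; rewrite !T_linear scalerDr addrACA. Qed.

Let DN x : D (- x) = - D x. Proof. exact: linearN. Qed.
Let D0 : D 0 = 0. Proof. exact: linear0. Qed.

Let comulM h l : D (h * l) =
  \tsum_(h1, h2 <- D h) \tsum_(l1, l2 <- D l) (h1 * l1) ⊗ (h2 * l2).
Proof.
have bf : bilinear_for *:%R *:%R (fun h1 h2 : H4 => T h1 h2 l).
  split=> [v a u u'|u a v v'] /=; rewrite -tensor_sum_linearr;
  congr tensor_sum; apply/funext => x; apply/funext => y;
  by rewrite mulrDl -scalerAl !tensE ?tensZl ?tensZr.
rewrite -[RHS]/(tensor_sum (D h) (fun h1 h2 => T h1 h2 l)).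
move: h; apply: (@sweedler4_eq _
  (fun h => D (h * l)) (fun h => tensor_sum (D h) _)).
- by move=> a x y; rewrite mulrDl -scalerAl linearP.
- exact: sweedler4_sum_linear.
- rewrite (sweedler4_sum1 bf); move: l {bf}; apply: comulM_basis.
  + exact: T_linear.
  + by rewrite T1 D1.
  + by rewrite Tg !mulE Dg.
  + by rewrite Tnu !mul1r Dnu.
  + by rewrite Tgnu !mul1r Dgnu.
- rewrite (sweedler4_sumg bf); move: l {bf}; apply: comulM_basis.
  + exact: T_linear.
  + by rewrite T1 Dg.
  + by rewrite Tg !mulE D1.
  + by rewrite Tnu mul_gg Dgnu.
  + by rewrite Tgnu !mulE Dnu.
- rewrite (sweedler4_sumnu bf); move: l {bf}; apply: comulM_basis.
  + exact: TD_linear.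
  + by rewrite !T1 Dnu.
  + by rewrite !Tg !mulE DN Dgnu !tensE opprD.
  + by rewrite !Tnu !mulE D0 !tensE !addr0 add0r subrr.
  + by rewrite !Tgnu !mulE D0 !tensE addr0 add0r addNr.
- rewrite (sweedler4_sumgnu bf); move: l {bf}; apply: comulM_basis.
  + exact: TD_linear.
  + by rewrite !T1 Dgnu.
  + by rewrite !Tg !mulE DN Dnu !tensE opprD.
  + by rewrite !Tnu !mulE D0 !tensE addr0 add0r subrr.
  + by rewrite !Tgnu !mulE D0 !tensE addr0 add0r addNr.
Qed.

#[local] Transparent sweedler4_comul sweedler4_ext sw_g sw_nu.

HB.instance Definition _ := isHopfAlgebra.Build K H4
  comulA counitl counitr D1 comulM (sweedler4_ext1 _ _ _ _) counitM
  antipodel antipoder.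

Lemma comul_g : comul g = g ⊗ g.
Proof. exact: sweedler4_extg. Qed.
Lemma comul_nu : comul nu = g ⊗ nu + nu ⊗ 1.
Proof. exact: sweedler4_extnu. Qed.
Lemma counit_g : counit g = 1 :> K.
Proof. exact: (@sweedler4_extg K^o 1 1 0 0). Qed.
Lemma counit_nu : counit nu = 0 :> K.
Proof. exact: (@sweedler4_extnu K^o 1 1 0 0). Qed.
Lemma antipode_g : antipode g = g.
Proof. exact: sweedler4_extg. Qed.
Lemma antipode_nu : antipode nu = - (g * nu).
Proof. exact: sweedler4_extnu. Qed.

Section TensorExtension.
Variables (V W : lmodType K) (M1 Mg Mnu Mgnu : {linear V -> W}).

(* The linear map sending 1 ⊗ v, g ⊗ v, nu ⊗ v, (g * nu) ⊗ v to               *)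
(* M1 v, Mg v, Mnu v, Mgnu v.                                                 *)
Definition sweedler4_tensor_ext (t : (H4 ⊗ V)%type) : W :=
  \tsum_(h, v <- t) sweedler4_ext (M1 v) (Mg v) (Mnu v) (Mgnu v) h.

Let ext_bilin : bilinear_for *:%R *:%R
  (fun h v => sweedler4_ext (M1 v) (Mg v) (Mnu v) (Mgnu v) h).
Proof.
split=> [v a x y|h a v w] /=; first exact: linearP.
have ME (M : {linear V -> W}) c :
    c *: M (a *: v + w) = a *: (c *: M v) + c *: M w.
  by rewrite linearP scalerDr !scalerA mulrC.
rewrite /sweedler4_ext /ssquat_ext !ME.
by do 3![rewrite ?scalerDr [RHS]addrACA; congr (_ + _)].
Qed.

Lemma sweedler4_tensor_extE h v : sweedler4_tensor_ext (h ⊗ v) =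
  sweedler4_ext (M1 v) (Mg v) (Mnu v) (Mgnu v) h.
Proof. exact: tensor_sum_tens. Qed.

HB.instance Definition _ := GRing.isLinear.Build K (H4 ⊗ V)%type W _
  sweedler4_tensor_ext (tensor_sum_linear ext_bilin).
End TensorExtension.

End SweedlerHopfAlgebra.

Arguments sw_g {K}.
Arguments sw_nu {K}.

Section ActionAndCocycle.
Variables (K : comNzRingType) (k1 k2 k3 k4 l1 l2 l3 l4 : K).
Local Notation Hss := (ssquat K).
Local Notation H4 := (sweedler4 K).
(* Rows of values on 1, e1, e2, e3, resp. on 1, g, nu, g nu.                  *)
Local Notation act_row := (ssquat_ext (W := Hss)).
Local Notation omega_row := (sweedler4_ext (W := Hss)).

Definition sweedler4_act : (H4 ⊗ Hss)%type -> Hss :=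
  sweedler4_tensor_ext (V := Hss) (W := Hss)
    (act_row 1 e1 e2 e3)
    (act_row 0 0 0 0)
    (act_row (k1 *: 1 + k2 *: e1 + k3 *: e2 - k4 *: e3)
             (k2 *: 1 + k1 *: e1 + k4 *: e2 - k3 *: e3)
             (k1 *: e2 + k2 *: e3)
             (k2 *: e2 + k1 *: e3))
    (act_row (l1 *: 1 + l2 *: e1 + l3 *: e2 + l4 *: e3)
             (l2 *: 1 + l1 *: e1 + l4 *: e2 + l3 *: e3)
             (l1 *: e2 - l2 *: e3)
             (- (l2 *: e2) + l1 *: e3)).
HB.instance Definition _ := GRing.Linear.on sweedler4_act.

Definition sweedler4_omega : (H4 ⊗ H4)%type -> Hss :=
  sweedler4_tensor_ext (V := H4) (W := Hss)
    (omega_row 1 0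
       (k1 *: 1 + k2 *: e1 + k3 *: e2 - k4 *: e3)
       (l1 *: 1 + l2 *: e1 + l3 *: e2 + l4 *: e3))
    (omega_row 0 0 0 0)
    (omega_row
       (k1 *: 1 + k2 *: e1 + k3 *: e2 - k4 *: e3)
       0
       ((k1 ^+ 2 + k2 ^+ 2) *: 1 + (2 * k1 * k2) *: e1
        + (2 * k1 * k3) *: e2 - (2 * k1 * k4) *: e3)
       ((k1 * l1 + k2 * l2) *: 1 + (k2 * l1 + k1 * l2) *: e1
        + (k3 * l1 + k4 * l2 + k1 * l3 + k2 * l4) *: e2
        + (- (k4 * l1) - k3 * l2 + k2 * l3 + k1 * l4) *: e3))
    (omega_row
       (l1 *: 1 + l2 *: e1 + l3 *: e2 + l4 *: e3)
       0
       ((k1 * l1 + k2 * l2) *: 1 + (k2 * l1 + k1 * l2) *: e1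
        + (k3 * l1 + k4 * l2 + k1 * l3 + k2 * l4) *: e2
        + (- (k4 * l1) - k3 * l2 + k2 * l3 + k1 * l4) *: e3)
       0).
HB.instance Definition _ := GRing.Linear.on sweedler4_omega.

End ActionAndCocycle.

(* Main.v *)
Require Import Defs.
From mathcomp Require Import all_boot all_order all_algebra reals.
From mathcomp Require Import boolp ring.
Import GRing.Theory.
Local Open Scope ring_scope.

(** Put p = nu . 1 and q = (g nu) . 1. Since g acts by zero, the coproducts
    Delta(nu) = g ⊗ nu + nu ⊗ 1 and Delta(g nu) = 1 ⊗ g nu + g nu ⊗ g turn
    multiplicativity of the action into nu . (ab) = (nu . a) b and
    (g nu) . (ab) = a ((g nu) . b): thus nu acts by left multiplication by p
    and g nu by right multiplication by q. The given tables are exactly these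
    two multiplications for p = k1 + k2 e1 + k3 e2 - k4 e3 and
    q = l1 + l2 e1 + l3 e2 + l4 e3 ([sweedler4_act_basis]), and the cocycle
    consists of h . 1 on the border and of p p, p q, p q, 0 on the pairs formed
    by nu and g nu ([sweedler4_omega_basis]).

    The two axioms for the cocycle hold for any two elements p and q of any
    algebra ([one_sided_twisted_partial_action]). Each of them is an equality of
    convolution products of bilinear maps on H_4, hence of bilinear maps
    ([bilinear_convolution]), so it is enough to compare values at the sixteen
    pairs of basis elements, where a convolution is a sum of at most four terms
    ([convolution_basis]). Most terms contain an action of g or a cocycle value
    at g, and vanish. For instance at (nu, g nu) both sides of the twisted
    associativity are p a q. Only (g nu, g nu) has a cancellation: its right
    hand side is q ((g nu g) . a) + q ((g g nu) . a) = - q p a + q p a = 0. *)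

Set Implicit Arguments.
Unset Strict Implicit.
Unset Printing Implicit Defensive.

Local Notation bilinear_map := (bilinear_for *:%R *:%R).

(** * Bilinear maps and convolution *)

Section BilinearMaps.
Variables (K : comNzRingType) (U V : lmodType K).

Lemma bilinear_tens (W : lmodType K) (f : {linear (U ⊗ V)%type -> W}) :
  bilinear_map (fun u v => f (u ⊗ v)).
Proof.
by split=> [v a u u'|u a v v']; rewrite /= -linearP;
  congr (f _); [apply: (tens_bilinear U V).1 | apply: (tens_bilinear U V).2].
Qed.

Lemma bilinear_mul (A : algType K) (f : U -> A) (f' : V -> A) :
  linear f -> linear f' -> bilinear_map (fun u v => f u * f' v).
Proof.
move=> lf lf'; split=> [v a x y|u a x y] /=.
  by rewrite lf mulrDl scalerAl.
by rewrite lf' mulrDr scalerAr.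
Qed.

Lemma tensor_sum_linear_param (W X : lmodType K) (t : (U ⊗ V)%type)
    (f : U -> V -> W -> X) :
  (forall u v, linear (f u v)) -> linear (fun w => \tsum_(u, v <- t) f u v w).
Proof.
move=> lf a x y; rewrite -tensor_sum_linearr; congr tensor_sum.
by apply/funext => u; apply/funext => v; rewrite lf.
Qed.
End BilinearMaps.

Section Convolution.
Variables (K : comNzRingType) (H : hopfAlgType K) (A : algType K).
Variables u v : H -> H -> A.

(** For bilinear u and v this is their product in the convolution algebra
    Hom(H ⊗ H, A), where H ⊗ H has the tensor product coalgebra structure. *)
Definition convolution (h l : H) : A :=
  \tsum_(h1, h2 <- comul h) \tsum_(l1, l2 <- comul l) u h1 l1 * v h2 l2.

Hypotheses (bu : bilinear_map u) (bv : bilinear_map v).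

Lemma bilinear_convolution_inner h1 h2 :
  bilinear_map (fun l1 l2 => u h1 l1 * v h2 l2).
Proof. exact: bilinear_mul (bu.2 h1) (bv.2 h2). Qed.

Lemma bilinear_convolution_outer l :
  bilinear_map (fun h1 h2 => \tsum_(l1, l2 <- comul l) (u h1 l1 * v h2 l2)).
Proof.
by split=> [h2|h1]; apply: tensor_sum_linear_param => l1 l2;
  [apply: (bilinear_mul (bu.1 l1) (bv.1 l2)).1
  |apply: (bilinear_mul (bu.1 l1) (bv.1 l2)).2].
Qed.

Lemma bilinear_convolution : bilinear_map convolution.
Proof.
split=> [l a x y|h] /=.
  rewrite /convolution linearP.
  exact: tensor_sum_linear (bilinear_convolution_outer l) _ _ _.
apply: tensor_sum_linear_param => h1 h2 a x y; rewrite linearP.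
exact: tensor_sum_linear (bilinear_convolution_inner h1 h2) _ _ _.
Qed.

End Convolution.

(** * Computing on the basis of the Sweedler algebra *)

(** Indexing the basis by a finite type lets products, coproducts and the tables
    of the action and of the cocycle be defined by pattern matching, so that
    identities on basis elements reduce by case analysis on the indices. *)
Variant sw_index := I1 | Ig | Inu | Ignu.

Section SweedlerBasis.
Variable K : comNzRingType.
Local Notation H4 := (sweedler4 K).

Definition sw_basis (i : sw_index) : H4 :=
  match i with I1 => 1 | Ig => sw_g | Inu => sw_nu | Ignu => sw_g * sw_nu end.
Arguments sw_basis : simpl never.

(** The terms of the coproduct of a basis element are tensors of basis elements
    with coefficient one, so pairs of indices describe it. *)
Definition sw_comul (i : sw_index) : seq (sw_index * sw_index) :=
  match i with
  | I1 => [:: (I1, I1)]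
  | Ig => [:: (Ig, Ig)]
  | Inu => [:: (Ig, Inu); (Inu, I1)]
  | Ignu => [:: (I1, Ignu); (Ignu, Ig)]
  end.

Definition sw_mul (i j : sw_index) : H4 :=
  match i, j with
  | I1, k | k, I1 => sw_basis k
  | Ig, Ig => sw_basis I1
  | Ig, Inu => sw_basis Ignu
  | Ig, Ignu => sw_basis Inu
  | Inu, Ig => - sw_basis Ignu
  | Ignu, Ig => - sw_basis Inu
  | _, _ => 0
  end.

Lemma sw_basisM i j : sw_basis i * sw_basis j = sw_mul i j.
Proof.
have nu_g : @sw_nu K * sw_g = - (sw_g * sw_nu).
  by apply/eqP; rewrite -addr_eq0 addrC mul_gnu.
have g_gnu : @sw_g K * (sw_g * sw_nu) = sw_nu by rewrite mulrA mul_gg mul1r.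
have nu_gnu : @sw_nu K * (sw_g * sw_nu) = 0.
  by rewrite mulrA nu_g mulNr -mulrA mul_nunu mulr0 oppr0.
have gnu_g : (@sw_g K * sw_nu) * sw_g = - sw_nu.
  by rewrite -mulrA nu_g mulrN g_gnu.
have gnu_nu : (@sw_g K * sw_nu) * sw_nu = 0 by rewrite -mulrA mul_nunu mulr0.
have gnu_gnu : (@sw_g K * sw_nu) * (sw_g * sw_nu) = 0.
  by rewrite -mulrA nu_gnu mulr0.
case: i; first exact: mul1r.
all: case: j; first exact: mulr1.
- exact: mul_gg.
- by [].
- exact: g_gnu.
- exact: nu_g.
- exact: mul_nunu.
- exact: nu_gnu.
- exact: gnu_g.
- exact: gnu_nu.
- exact: gnu_gnu.
Qed.

Lemma sweedler4_ext_basis (W : lmodType K) (w0 w1 w2 w3 : W) i :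
  sweedler4_ext w0 w1 w2 w3 (sw_basis i) =
  match i with I1 => w0 | Ig => w1 | Inu => w2 | Ignu => w3 end.
Proof.
case: i; [exact: sweedler4_ext1 | exact: sweedler4_extg
         | exact: sweedler4_extnu | exact: sweedler4_extgnu].
Qed.

Lemma sw_basis_eq (W : lmodType K) (L M : H4 -> W) :
  linear L -> linear M -> (forall i, L (sw_basis i) = M (sw_basis i)) ->
  forall h, L h = M h.
Proof.
by move=> lL lM E; apply: sweedler4_eq lL lM (E I1) (E Ig) (E Inu) (E Ignu).
Qed.

Lemma sw_basis_bilinear_eq (W : lmodType K) (f f' : H4 -> H4 -> W) :
  bilinear_map f -> bilinear_map f' ->
  (forall i j, f (sw_basis i) (sw_basis j) = f' (sw_basis i) (sw_basis j)) ->
  forall h l, f h l = f' h l.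
Proof.
move=> bf bf' E h l; move: h; apply: sw_basis_eq (bf.1 l) (bf'.1 l) _ => i.
by move: l; apply: sw_basis_eq (bf.2 _) (bf'.2 _) (E i).
Qed.

Lemma tensor_sum_comul_basis (W : lmodType K) (f : H4 -> H4 -> W) i :
  bilinear_map f ->
  tensor_sum (comul (sw_basis i)) f =
  \sum_(s <- sw_comul i) f (sw_basis s.1) (sw_basis s.2).
Proof.
move=> bf; case: i; rewrite ?big_cons big_nil addr0.
- exact: sweedler4_sum1 bf.
- exact: sweedler4_sumg bf.
- exact: sweedler4_sumnu bf.
- exact: sweedler4_sumgnu bf.
Qed.

Lemma convolution_basis (A : algType K) (u v : H4 -> H4 -> A) i j :
  bilinear_map u -> bilinear_map v ->
  convolution u v (sw_basis i) (sw_basis j) =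
  \sum_(s <- sw_comul i) \sum_(t <- sw_comul j)
    u (sw_basis s.1) (sw_basis t.1) * v (sw_basis s.2) (sw_basis t.2).
Proof.
move=> bu bv; rewrite /convolution tensor_sum_comul_basis; last first.
  exact: bilinear_convolution_outer.
apply: eq_bigr => s _; rewrite tensor_sum_comul_basis //.
exact: bilinear_convolution_inner.
Qed.

End SweedlerBasis.

Arguments sw_basis : simpl never.

(** * Twisted partial actions by one-sided multiplications *)

Section OneSidedAction.
Variables (K : comNzRingType) (A : algType K) (p q : A).
Local Notation H4 := (sweedler4 K).
Local Notation basis := (sw_basis K).

Definition one_sided_act (i : sw_index) (a : A) : A :=
  match i with I1 => a | Ig => 0 | Inu => p * a | Ignu => a * q end.

(** The value at (g nu, g nu) is a choice: the axioms only ask that it commute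
    with every element of A. *)
Definition one_sided_cocycle (i j : sw_index) : A :=
  match i, j with
  | Ig, _ | _, Ig => 0
  | I1, k | k, I1 => one_sided_act k 1
  | Inu, Inu => p * p
  | Ignu, Ignu => 0
  | _, _ => p * q
  end.

Variables (act : {linear (H4 ⊗ A)%type -> A}).
Variables (omega : {linear (H4 ⊗ H4)%type -> A}).
Hypothesis actE : forall i a, act (basis i ⊗ a) = one_sided_act i a.
Hypothesis omegaE :
  forall i j, omega (basis i ⊗ basis j) = one_sided_cocycle i j.

Let act_mulE i j a : act ((basis i * basis j) ⊗ a) =
  match i, j with
  | I1, k | k, I1 => one_sided_act k a
  | Ig, Ig => a
  | Ig, Inu => a * q
  | Ig, Ignu => p * a
  | Inu, Ig => - (a * q)
  | Ignu, Ig => - (p * a)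
  | _, _ => 0
  end.
Proof.
rewrite sw_basisM.
by case: i; case: j; rewrite /sw_mul ?tensNl ?tens0l ?linearN ?linear0 /= ?actE.
Qed.

Let bilinear_act_act a : bilinear_map (fun h l => act (h ⊗ act (l ⊗ a))).
Proof.
have B := bilinear_tens act.
split=> [l c x y|h c x y] /=; first by rewrite B.1.
by rewrite B.1 /= B.2.
Qed.

Let bilinear_act_mul a : bilinear_map (fun h l => act ((h * l) ⊗ a)).
Proof.
have B := bilinear_tens act.
split=> [l c x y|h c x y] /=; first by rewrite mulrDl -scalerAl B.1.
by rewrite mulrDr -scalerAr B.1.
Qed.

Let bilinear_omega : bilinear_map (fun h l => omega (h ⊗ l)) :=
  bilinear_tens omega.

Let simpA := (mul1r, mulr1, mulr0, mul0r, add0r, addr0, mulrN, mulrA, addNr).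

Lemma one_sided_twisted_partial_action : twisted_partial_action act omega.
Proof.
split.
- exact: actE I1.
- move=> h a b.
  have act_linear c : linear (fun h => act (h ⊗ c)) := (bilinear_tens act).1 c.
  have bf := bilinear_mul (act_linear a) (act_linear b).
  move: h; apply: sw_basis_eq => //.
    by move=> c x y; rewrite linearP; apply: tensor_sum_linear bf _ _ _.
  move=> i; rewrite (tensor_sum_comul_basis _ bf).
  by case: i; rewrite /sw_comul ?big_cons big_nil /= !actE /= ?simpA.
- move=> h l a; move: h l; apply: (sw_basis_bilinear_eq
    (bilinear_convolution (bilinear_act_act a) bilinear_omega)
    (bilinear_convolution bilinear_omega (bilinear_act_mul a))) => i j.
  rewrite !convolution_basis //.
  case: i; case: j; rewrite /sw_comul !(big_cons, big_nil) /=;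
    by rewrite !(actE, omegaE, act_mulE) /= ?actE ?simpA.
- apply: (sw_basis_bilinear_eq bilinear_omega
    (bilinear_convolution bilinear_omega (bilinear_act_mul 1))) => i j.
  rewrite !convolution_basis //.
  case: i; case: j; rewrite /sw_comul !(big_cons, big_nil) /=;
    by rewrite !(omegaE, act_mulE) /= ?simpA.
Qed.

End OneSidedAction.

(** * The action and the cocycle on the split semi-quaternions *)

Section SplitSemiQuaternionTables.
Variables (K : comNzRingType) (k1 k2 k3 k4 l1 l2 l3 l4 : K).

Let p : ssquat K := k1 *: 1 + k2 *: e1 + k3 *: e2 - k4 *: e3.
Let q : ssquat K := l1 *: 1 + l2 *: e1 + l3 *: e2 + l4 *: e3.

Lemma ssquat_ext_mull (x w1 w2 w3 a : ssquat K) :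
  x * e1 = w1 -> x * e2 = w2 -> x * e3 = w3 ->
  ssquat_ext x w1 w2 w3 a = x * a.
Proof.
move=> <- <- <-.
by rewrite [in RHS](ssquat_basis a) !mulrDr -!scalerAr mulr1.
Qed.

Lemma ssquat_ext_mulr (x w1 w2 w3 a : ssquat K) :
  e1 * x = w1 -> e2 * x = w2 -> e3 * x = w3 ->
  ssquat_ext x w1 w2 w3 a = a * x.
Proof.
move=> <- <- <-.
by rewrite [in RHS](ssquat_basis a) !mulrDl -!scalerAl mul1r.
Qed.

Let ssquat_oneE : 1 = (1, 0, 0, 0) :> ssquat K. Proof. by []. Qed.

Ltac ssquat_ring :=
  rewrite /p /q /e1 /e2 /e3 ?ssquat_oneE -?scaleNr ?ssquat_scaleE ?ssquat_addE
    ?ssquat_mulE /ssquat_mul;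
  do 3?[congr pair]; rewrite /=; ring.

Lemma sweedler4_act_basis i a :
  sweedler4_act k1 k2 k3 k4 l1 l2 l3 l4 (sw_basis K i ⊗ a) =
  one_sided_act p q i a.
Proof.
rewrite /sweedler4_act sweedler4_tensor_extE sweedler4_ext_basis.
case: i => /=.
- by rewrite [RHS]ssquat_basis.
- by rewrite /ssquat_ext !scaler0 !addr0.
- by apply: ssquat_ext_mull; ssquat_ring.
- by apply: ssquat_ext_mulr; ssquat_ring.
Qed.

Lemma sweedler4_omega_basis i j :
  sweedler4_omega k1 k2 k3 k4 l1 l2 l3 l4 (sw_basis K i ⊗ sw_basis K j) =
  one_sided_cocycle p q i j.
Proof.
rewrite /sweedler4_omega sweedler4_tensor_extE sweedler4_ext_basis.
case: i; rewrite /= sweedler4_ext_basis; case: j => //=;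
  rewrite ?mulr1 ?mul1r //.
(* The pairs left are (nu, nu), (nu, g nu) and (g nu, nu). *)
all: ssquat_ring.
Qed.

End SplitSemiQuaternionTables.

Theorem theorem3p1 (R : realType) (k1 k2 k3 k4 l1 l2 l3 l4 : R) :
  twisted_partial_action (sweedler4_act k1 k2 k3 k4 l1 l2 l3 l4)
    (sweedler4_omega k1 k2 k3 k4 l1 l2 l3 l4).
Proof.
apply: one_sided_twisted_partial_action.
- exact: sweedler4_act_basis.
- exact: sweedler4_omega_basis.
Qed.
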